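(* Let $c_d$ be the total number of combinatorial classes in the space $\Xi_d$ of monic and centered complex polynomial vector fields of degree $d$, and let $R$ be the radius of convergence of the generating function $G(z)=\sum_{d\ge 1}c_dz^d$. Then $R=\frac{11-5\sqrt5}{-2}$, one has $\frac1R=\lim_{d\to\infty}\sqrt[d]{c_d}$, and $$c_d\sim (1/R)^d=\left(\frac{-2}{11-5\sqrt5}\right)^d\approx (11.09)^d .$$
   Context: Let $d\ge 2$. $\Xi_d\simeq\mathbb{C}^{d-1}$ is the space of vector fields $\xi_P=P(z)\frac{d}{dz}$ on $\mathbb{C}$ with $P(z)=z^d+a_{d-2}z^{d-2}+\dots+a_0$ a monic centered complex polynomial; trajectories are solutions of $\dot z=P(z)$ in real time. Separatrices. The point $\infty$ is a pole of order $d-2$ of $\xi_P$, and there are $2d-2$ trajectory directions at $\infty$, with asymptotic angles $\frac{2\pi\ell}{2d-2}$, $\ell\in\mathbb{Z}/(2d-2)$; those with $\ell$ even are incoming to $\infty$, those with $\ell$ odd are outgoing from $\infty$. The separatrix $s_\ell$ is the maximal trajectory with asymptotic direction $\ell$ at $\infty$. Every separatrix is either landing (its other end tends to an equilibrium point) or homoclinic (it joins $\infty$ to $\infty$); a homoclinic separatrix is written $s_{k,j}$, where $k$ odd and $j$ even are its two asymptotic directions. The end $e_\ell$ is $\infty$ with access between $s_{\ell-1}$ and $s_\ell$. The zones of $\xi_P$ are the connected components of $\mathbb{C}$ minus the closure of the union of all separatrices; an $\alpha\omega$-zone is a zone all of whose trajectories have the same $\alpha$-limit equilibrium point and the same $\omega$-limit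 equilibrium point, these two points being distinct. Each $\alpha\omega$-zone has on its boundary exactly one odd end $e_k$ and exactly one even end $e_j$ such that $s_k$ and $s_j$ are landing; the distinguished transversal $T_{k,j}$ of the zone is the geodesic, in the metric with length element $\frac{|dz|}{|P(z)|}$, inside the zone joining these two ends. Combinatorial data. A combinatorial data set $(\iota,H,T)$ of degree $d$ consists of an involution $\iota$ of $\mathbb{Z}/(2d-2)$ and disjoint subsets $H,T\subset\mathbb{Z}/(2d-2)$ with $H\cup T=\{\ell:\iota(\ell)\neq\ell\}$ such that: (i) if $\iota(\ell)\ne\ell$ then $\ell$ and $\iota(\ell)$ have different parity; (ii) $\iota$ is non-crossing, i.e. the pairs $\{\ell,\iota(\ell)\}$ with $\iota(\ell)\ne \ell$ are pairwise non-crossing when $\mathbb{Z}/(2d-2)$ is placed in cyclic order on a circle; (iii) if $\iota(\ell)\neq\ell$, then $\ell,\iota(\ell)$ are both in $H$ or both in $T$. The data set of $\xi_P$ has as pairs in $H$ the $\{k,j\}$ for the homoclinic separatrices $s_{k,j}$, as pairs in $T$ the $\{k,j\}$ for the distinguished transversals $T_{k,j}$, and all other indices fixed by $\iota$. A combinatorial class in $\Xi_d$ is the set of all vector fields in $\Xi_d$ with a given combinatorial data set. It is known that every combinatorial data set of degree $d$ is realized by some $\xi_P\in\Xi_d$. So $c_d$ is the number of combinatorial data sets of degree $d$; in the generating function $G$ one puts $c_1=1$.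
   Formalization: ''c_d ~ (1/R)^d'' is read as equality of exponential order, i.e. the d-th root of c_d/(1/R)^d tends to 1; with the usual meaning (ratio tends to 1) it is false, since the sum of c_d R^d converges and so c_d R^d tends to 0. *)

(* Defs.v *)
From HB Require Import structures.
From mathcomp Require Export all_boot all_order all_algebra.
From mathcomp Require Export complex.
From mathcomp Require Export all_classical all_reals all_analysis.
Export Order.TTheory GRing.Theory Num.Theory.
Export numFieldNormedType.Exports.

Set Implicit Arguments.
Unset Strict Implicit.
Unset Printing Implicit Defensive.

Local Open Scope ring_scope.
Local Open Scope complex_scope.

(* [Z/(2d-2)] is represented by ['I_(2 * d - 2)]; the parity of a class is that
   of its representative, the modulus being even. *)
Definition comb_data (d : nat) : Type :=
  ({ffun 'I_(2 * d - 2) -> 'I_(2 * d - 2)} *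
   {set 'I_(2 * d - 2)} * {set 'I_(2 * d - 2)})%type.

(* Non-crossing: two chords of a circle cross iff, after naming the end points
   suitably, they read [l < m < iota l < iota m] when the circle is cut open
   just before 0. *)
Definition is_comb_data (d : nat) (D : comb_data d) : bool :=
  let: (iota, H, T) := D in
  [&& [forall l : 'I__, iota (iota l) == l],
      [disjoint H & T],
      H :|: T == [set l | iota l != l],
      [forall l : 'I__, (iota l != l) ==> (odd l != odd (iota l))],
      [forall l : 'I__, forall m : 'I__, ~~ [&& l < m, m < iota l & iota l < iota m]%N] &
      [forall l : 'I__, (iota l != l) ==>
         ((l \in H) && (iota l \in H) || (l \in T) && (iota l \in T))]].

Definition num_comb_data (d : nat) : nat :=
  #|[set D : {ffun 'I_(2 * d - 2) -> 'I_(2 * d - 2)} *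
             {set 'I_(2 * d - 2)} * {set 'I_(2 * d - 2)}
     | is_comb_data (d := d) D]|.

(* [c_d], computed from the data sets since each of them is realized, with the
   convention [c_1 = 1]; the generating function has no constant term. *)
Definition num_classes (d : nat) : nat :=
  match d with 0 => 0 | 1 => 1 | _ => num_comb_data d end%N.

Local Open Scope classical_set_scope.

Definition Xi (R : realType) (d : nat) : set {poly R[i]} :=
  [set P | [/\ P \is monic, size P = d.+1 & P`_d.-1 = 0]].

Definition cmod (R : realType) (w : R[i]) : R := complex.Re `|w|.

(* The real time line is cut to an open interval with end points in [\bar R];
   these are the filters of times tending to the lower, resp. upper, end point
   from inside. *)
Definition lower_end (R : realType) (a : \bar R) : set_system R :=
  filter_from [set s : R | (a < s%:E)%E]
              (fun s => [set t : R | (a < t%:E)%E /\ t < s]).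

Definition upper_end (R : realType) (b : \bar R) : set_system R :=
  filter_from [set s : R | (s%:E < b)%E]
              (fun s => [set t : R | s < t /\ (t%:E < b)%E]).

Definition solution (R : realType) (P : {poly R[i]}) (a b : \bar R)
    (z : R -> R[i]) : Prop :=
  forall t : R, (a < t%:E)%E -> (t%:E < b)%E ->
    is_derive t 1 (fun s => complex.Re (z s)) (complex.Re P.[z t]) /\
    is_derive t 1 (fun s => complex.Im (z s)) (complex.Im P.[z t]).

Definition maximal_trajectory (R : realType) (P : {poly R[i]}) (a b : \bar R)
    (z : R -> R[i]) : Prop :=
  [/\ (a < b)%E, solution P a b z &
      forall (a' b' : \bar R) (w : R -> R[i]),
        (a' <= a)%E -> (b <= b')%E -> solution P a' b' w ->
        (forall t : R, (a < t%:E)%E -> (t%:E < b)%E -> w t = z t) ->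
        a' = a /\ b' = b].

Definition tends_to (R : realType) (F : set_system R) (z : R -> R[i])
    (w : R[i]) : Prop :=
  (fun t => z t : R[i]^o) @ F --> (w : R[i]^o).

Definition tends_to_infty (R : realType) (F : set_system R) (z : R -> R[i])
    (theta : R) : Prop :=
  [/\ (fun t => cmod (z t)) @ F --> +oo,
      (fun t => complex.Re (z t) / cmod (z t)) @ F --> cos theta &
      (fun t => complex.Im (z t) / cmod (z t)) @ F --> sin theta].

Definition asympt_angle (R : realType) (d : nat) (l : R) : R :=
  2 * pi * l / (2 * d - 2)%:R.

(* [z], on [(a, b)], is a parametrization of [s_l]: even directions are reached
   in forward time, odd ones in backward time. *)
Definition separatrix (R : realType) (d : nat) (P : {poly R[i]})
    (l : 'I_(2 * d - 2)) (a b : \bar R) (z : R -> R[i]) : Prop :=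
  maximal_trajectory P a b z /\
  tends_to_infty (if odd l then lower_end a else upper_end b) z
                 (asympt_angle d l%:R).

Definition landing (R : realType) (d : nat) (P : {poly R[i]})
    (l : 'I_(2 * d - 2)) : Prop :=
  exists (a b : \bar R) (z : R -> R[i]) (w : R[i]),
    [/\ separatrix P l a b z, root P w &
        tends_to (if odd l then upper_end b else lower_end a) z w].

Definition homoclinic (R : realType) (d : nat) (P : {poly R[i]})
    (k j : 'I_(2 * d - 2)) : Prop :=
  exists (a b : \bar R) (z : R -> R[i]),
    [/\ odd k, ~~ odd j, separatrix P k a b z & separatrix P j a b z].

Definition separatrix_union (R : realType) (d : nat) (P : {poly R[i]}) :
    set R[i]^o :=
  [set w | exists (l : 'I_(2 * d - 2)) (a b : \bar R) (z : R -> R[i]) (t : R),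
     [/\ separatrix P l a b z, (a < t%:E)%E, (t%:E < b)%E & w = z t]].

Definition zone (R : realType) (d : nat) (P : {poly R[i]}) (Z : set R[i]^o) :
    Prop :=
  exists2 w, (~` closure (separatrix_union d P)) w &
    Z = connected_component (~` closure (separatrix_union d P)) w.

Definition alphaomega_zone (R : realType) (d : nat) (P : {poly R[i]})
    (Z : set R[i]^o) : Prop :=
  zone d P Z /\
  exists alpha omega : R[i],
    [/\ root P alpha, root P omega, alpha != omega &
        forall (a b : \bar R) (z : R -> R[i]) (t : R),
          maximal_trajectory P a b z -> (a < t%:E)%E -> (t%:E < b)%E ->
          Z (z t) ->
          tends_to (lower_end a) z alpha /\ tends_to (upper_end b) z omega].

(* [g] tends to the end [e_l], i.e. to infinity between [s_(l-1)] and [s_l].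
   Infinity is at finite distance for [|dz| / |P(z)|], and the geodesics
   considered below reach it with a direction strictly between those of the two
   separatrices; only curves with such a limit direction are considered. *)
Definition tends_to_end (R : realType) (d : nat) (F : set_system R)
    (g : R -> R[i]) (l : 'I_(2 * d - 2)) : Prop :=
  exists theta : R,
    [/\ asympt_angle d (l%:R - 1) < theta, theta < asympt_angle d l%:R &
        tends_to_infty F g theta].

Definition C1_on_unit (R : realType) (f : R -> R) : Prop :=
  forall t : R, 0 < t < 1 -> derivable f t 1 /\ {for t, continuous (derive1 f)}.

Definition joins_ends (R : realType) (d : nat) (Z : set R[i]^o)
    (k j : 'I_(2 * d - 2)) (g : R -> R[i]) : Prop :=
  [/\ C1_on_unit (fun t => complex.Re (g t)),
      C1_on_unit (fun t => complex.Im (g t)),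
      forall t : R, 0 < t < 1 -> Z (g t),
      tends_to_end (lower_end 0%:E) g k &
      tends_to_end (upper_end 1%:E) g j].

Definition flat_length (R : realType) (P : {poly R[i]}) (g : R -> R[i]) :
    \bar R :=
  (\int[lebesgue_measure]_(t in `]0%R, 1%R[)
     (cmod (derive1 (fun s => complex.Re (g s)) t +i*
            derive1 (fun s => complex.Im (g s)) t) / cmod P.[g t])%:E)%E.

(* The zone is a flat strip, where the geodesic between two boundary points is
   the shortest curve joining them. *)
Definition distinguished_transversal (R : realType) (d : nat)
    (P : {poly R[i]}) (k j : 'I_(2 * d - 2)) (g : R -> R[i]) : Prop :=
  [/\ odd k, ~~ odd j, landing P k, landing P j &
      exists Z : set R[i]^o,
        [/\ alphaomega_zone d P Z, joins_ends Z k j g &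
            forall h : R -> R[i], joins_ends Z k j h ->
              (flat_length P g <= flat_length P h)%E]].

Definition has_comb_data (R : realType) (d : nat) (P : {poly R[i]})
    (D : comb_data d) : Prop :=
  let: (iota, H, T) := D in
  forall k j : 'I_(2 * d - 2), odd k -> ~~ odd j ->
    (k \in H /\ iota k = j <-> homoclinic P k j) /\
    (k \in T /\ iota k = j <->
       exists g : R -> R[i], distinguished_transversal P k j g).

Definition comb_class (R : realType) (d : nat) (D : comb_data d) :
    set {poly R[i]} :=
  [set P | Xi d P /\ has_comb_data P D].

(* Nonempty classes only: those of the data sets that occur for some field. *)
Definition comb_classes (R : realType) (d : nat) : set (set {poly R[i]}) :=
  [set C | exists D : comb_data d,
     [/\ is_comb_data D, C = @comb_class R d D & C !=set0]].

Definition all_data_realized (R : realType) (d : nat) : Prop :=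
  forall D : comb_data d, is_comb_data D -> @comb_class R d D !=set0.

Definition convergence_radius (R : realType) (a : nat -> R) : \bar R :=
  ereal_sup [set `|x|%:E | x in [set x : R | cvgn (pseries a x)]].

(* Same exponential order: [a_d = theta_d * b_d] with a subexponential factor
   [theta], i.e. [theta_d ^ (1/d)] tends to 1. This is weaker than
   [a_d / b_d --> 1], which fails for [c_d] because of a factor [d ^ (-3/2)]. *)
Definition exp_equiv (R : realType) (a b : nat -> R) : Prop :=
  (a d / b d) `^ d%:R^-1 @[d --> \oo] --> (1 : R).

(* Main.v *)
Require Import Defs.
From mathcomp Require Import all_boot all_order all_algebra.
From mathcomp Require Import complex.
From mathcomp Require Import all_classical all_reals all_analysis.
From mathcomp Require Import zify ring lra.
Import Order.TTheory GRing.Theory Num.Theory.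
Import numFieldNormedType.Exports.
Set Implicit Arguments.
Unset Strict Implicit.
Unset Printing Implicit Defensive.

(** Cutting the circle open at 0 turns a combinatorial data set into a system of
    coloured non-crossing arcs joining points of different parity on a line of
    [2d - 2] points. Deleting the first point or its arc gives, for the
    generating functions E and O of the numbers of systems on an even or odd
    number of points,
      [E = 1 + x O + 2 x E^2] and [O = E + 2 x E O],
    so that [y = x E] satisfies [x (1 - y) = y (1 - 2 y)^2]. On [0 < y < 1/2]
    the quotient [y (1 - 2 y)^2 / (1 - y)] has maximum [(5 sqrt 5 - 11) / 2], at
    [y = (3 - sqrt 5) / 4]. The partial sums of E therefore stay bounded at
    this value of x and at no larger one. As juxtaposing arc systems makes the
    coefficients of E supermultiplicative, one large term forces all later ones
    to be large, which turns the radius of convergence into a limit of roots. *)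

(** * Coloured non-crossing arc systems on an interval, and their decomposition at the first
    point *)

Section ArcSystems.
Variable n : nat.
Implicit Types (a b p q : nat) (f g h : {ffun 'I_n -> 'I_n * bool}).

(* [f l] is the partner of [l] with the colour of its arc. An unmatched point is
   its own partner, with the dummy colour [false], as are all points outside [a, b). *)
Definition arc_system a b f : bool :=
  [forall l : 'I_n, (f (f l).1 == (l, (f l).2)) &&
     ((f l == (l, false)) || [&& a <= l, l < b & odd l != odd (f l).1])] &&
  [forall l : 'I_n, forall m : 'I_n, ~~ [&& l < m, m < (f l).1 & (f l).1 < (f m).1]].

Lemma arc_systemP a b f :
  reflect [/\ forall l, f (f l).1 = (l, (f l).2),
              forall l, f l = (l, false) \/ [/\ a <= l, l < b & odd l != odd (f l).1] &
              forall l m : 'I_n, l < m -> m < (f l).1 -> (f l).1 < (f m).1 -> False]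
          (arc_system a b f).
Proof.
apply: (iffP andP) => [[/forallP fP /forallP ncP]|[fI fS fN]].
  split=> [l|l|l m lm ml fml].
  - by have /andP[/eqP] := fP l.
  - by have /andP[_ /orP[/eqP|/and3P]] := fP l; [left|right].
  - by have /forallP/(_ m) := ncP l; rewrite lm ml fml.
split; apply/forallP => l.
  rewrite fI eqxx /=; apply/orP.
  by have [->|/and3P] := fS l; [left|right].
apply/forallP => m; apply/negP => /and3P[lm ml fml]; exact: (fN l m).
Qed.

Definition arc_systems a b := [set f | arc_system a b f].

(** The partner of a matched point is itself matched, by involutivity, so the bounds apply to it as
    well. *)
Lemma arc_system_range a b f (l : 'I_n) :
  arc_system a b f -> a <= l < b -> a <= (f l).1 < b.
Proof.
case/arc_systemP => fI fS _ lab.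
have [->//|[_ _ odl]] := fS l.
have [e|[-> -> //]] := fS (f l).1.
by have := fI l; rewrite e => -[e1 _]; rewrite e1 eqxx in odl.
Qed.

Lemma arc_system_out a b f (l : 'I_n) :
  arc_system a b f -> ~~ (a <= l < b) -> f l = (l, false).
Proof. by case/arc_systemP => _ fS _; have [//|[-> -> _]] := fS l. Qed.

Lemma arc_systems_nil a b : b <= a -> #|arc_systems a b| = 1.
Proof.
move=> ba; apply/eqP/cards1P; exists [ffun l => (l, false)].
apply/setP => f; rewrite !inE; apply/idP/eqP => [fA|->].
  apply/ffunP => l; rewrite ffunE (arc_system_out fA) //; lia.
by apply/arc_systemP; split=> [l|l|l m]; rewrite !ffunE //=; [left|lia].
Qed.

Definition restrict_arcs p q f : {ffun 'I_n -> 'I_n * bool} :=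
  [ffun l : 'I_n => if p <= l < q then f l else (l, false)].

Lemma arc_system_restrict a b p q f : arc_system a b f ->
  (forall l : 'I_n, p <= l < q -> p <= (f l).1 < q) ->
  arc_system p q (restrict_arcs p q f).
Proof.
move=> /arc_systemP[fI fS fN] st; apply/arc_systemP; split.
- move=> l; rewrite /restrict_arcs !ffunE; case: (boolP (p <= l < q)) => lpq.
    by rewrite st ?fI.
  by rewrite (negbTE lpq).
- move=> l; rewrite ffunE; case: ifP => [/andP[-> ->]|_]; last by left.
  by have [->|[_ _ ->]] := fS l; [left|right].
- move=> l m; rewrite !ffunE; do 2![case: ifP => /= _; try lia]; exact: fN.
Qed.

Section Glue.
Variables (b : nat) (x y : 'I_n) (c : bool).

(** The inverse of cutting a system along an arc from [x] to [y] of colour [c]. Points before [x]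
    fall to [g], which is trivial there. *)
Definition glue_arcs g h : {ffun 'I_n -> 'I_n * bool} :=
  [ffun l => if l == x then (y, c) else if l == y then (x, c)
             else if l < y then g l else h l].

Lemma ord_neq_lt (l m : 'I_n) : l != m -> (l < m) || (m < l).
Proof. by rewrite -val_eqE neq_ltn. Qed.

(** No crossing arises because the arcs of [g] stay strictly between [x] and [y] and those of [h]
    stay beyond [y]. *)
Lemma glue_arc_system g h : x < y -> y < b -> odd x != odd y ->
  arc_system x.+1 y g -> arc_system y.+1 b h ->
  arc_system x b (glue_arcs g h).
Proof.
move=> xy yb oxy gA hA.
have yx : (y == x) = false by apply/negbTE; rewrite -val_eqE /=; lia.
have [gI gS gN] := arc_systemP _ _ _ gA.
have [hI hS hN] := arc_systemP _ _ _ hA.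
have gin (l : 'I_n) : x < l -> l < y -> x < (g l).1 < y.
  by move=> xl ly; apply: (arc_system_range gA); rewrite xl.
have hin (l : 'I_n) : y < l -> y < (h l).1.
  move=> yl; have [lb|lb] := ltnP l b.
    by have /andP[] := arc_system_range hA (l := l) ltac:(lia).
  by rewrite (arc_system_out hA) //; lia.
have glt (l : 'I_n) : l < x -> g l = (l, false).
  by move=> lx; apply: (arc_system_out gA); lia.
have gluex : glue_arcs g h x = (y, c) by rewrite ffunE eqxx.
have gluey : glue_arcs g h y = (x, c) by rewrite ffunE yx eqxx.
have glueg (l : 'I_n) : l != x -> l < y -> glue_arcs g h l = g l.
  move=> lx ly; rewrite ffunE (negbTE lx) ly; case: eqP => // e.
  by rewrite e ltnn in ly.
have glueh (l : 'I_n) : y < l -> glue_arcs g h l = h l.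
  move=> yl; rewrite ffunE -!val_eqE /= ltnNge ltnW //=.
  by do 2![case: eqP => [|_]; first lia].
have cases (l : 'I_n) : l < x \/ [\/ l = x, l = y, x < l < y | y < l].
  case: (ltngtP l x) => [|xl|/val_inj]; [by left|right|by right; constructor 1].
  case: (ltngtP l y) => [ly| |/val_inj]; [|by constructor 4|by constructor 2].
  by constructor 3.
have neqx (l : 'I_n) : x < l -> l != x by rewrite -val_eqE /=; lia.
have neqx' (l : 'I_n) : l < x -> l != x by rewrite -val_eqE /=; lia.
apply/arc_systemP; split.
- move=> l; have [lx|[->|->|/andP[xl ly]|yl]] := cases l.
  + have ly : l < y by lia.
    by rewrite (glueg l) ?neqx' // glt //= (glueg l) ?neqx' // glt.
  + by rewrite gluex gluey.
  + by rewrite gluey gluex.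
  + have /andP[? ?] := gin l xl ly.
    by rewrite (glueg l) ?neqx // glueg ?neqx.
  + by rewrite (glueh l) // glueh ?hin.
- move=> l; have [lx|[->|->|/andP[xl ly]|yl]] := cases l.
  + by left; rewrite glueg ?neqx' ?glt //; lia.
  + by rewrite gluex; right; split=> //; lia.
  + by rewrite gluey; right; split; [exact: ltnW| |rewrite eq_sym].
  + rewrite glueg ?neqx //; have [->|[_ _ ?]] := gS l; [by left|right].
    by split=> //; lia.
  + rewrite glueh //; have [->|[_ ? ?]] := hS l; [by left|right].
    by split=> //; lia.
- move=> l m; have [lx|[->|->|/andP[xl ly]|yl]] := cases l.
  + by rewrite glueg ?neqx' ?glt //=; lia.
  + rewrite gluex /= => xm my.
    by rewrite glueg ?neqx //; have := gin m xm my; lia.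
  + by rewrite gluey /=; lia.
  + rewrite glueg ?neqx // => lm mgl; have /andP[_ gly] := gin l xl ly.
    rewrite glueg; [exact: gN| |]; last lia.
    by apply: neqx; lia.
  + by rewrite glueh // => lm; rewrite glueh; [exact: hN|lia].
Qed.

Lemma restrict_glue_l g h : arc_system x.+1 y g ->
  restrict_arcs x.+1 y (glue_arcs g h) = g.
Proof.
move=> gA; apply/ffunP => l; rewrite !ffunE.
case: ifP => [/andP[xl ly]|lxy]; last by rewrite (arc_system_out gA) ?lxy.
by rewrite -!val_eqE /= ly; do 2![case: eqP => [|_]; first lia].
Qed.

Lemma restrict_glue_r g h : x < y -> arc_system y.+1 b h ->
  restrict_arcs y.+1 b (glue_arcs g h) = h.
Proof.
move=> xy hA; apply/ffunP => l; rewrite !ffunE.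
case: ifP => [/andP[yl lb]|lxy]; last by rewrite (arc_system_out hA) ?lxy.
rewrite -!val_eqE /=; do 2![case: eqP => [|_]; first lia].
by rewrite ltnNge ltnW.
Qed.

(** An arc leaving the open interval would cross the arc from [x] to [y]; it cannot end at [x] or
    [y], which are matched with each other. *)
Lemma arc_system_inside f (l : 'I_n) : x < y -> arc_system x b f ->
  f x = (y, c) -> x < l < y -> x < (f l).1 < y.
Proof.
move=> xy fA fx /andP[xl ly]; have [fI fS fN] := arc_systemP _ _ _ fA.
have fy : f y = (x, c) by have := fI x; rewrite fx.
have yb : y < b.
  have [|[]//] := fS y; rewrite fy => -[] /(congr1 val) /=; lia.
have /andP[xfl _] := arc_system_range fA (l := l) ltac:(lia).
have := fN x l xl; rewrite fx /= => /(_ ly)/negP nlt.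
have /or3P[/eqP/val_inj e|/eqP/val_inj e|//] :
  [|| (x : nat) == (f l).1, (y : nat) == (f l).1 | x < (f l).1 < y] by lia.
- have := fI l; rewrite -e fx => -[] /(congr1 val) /=; lia.
- have := fI l; rewrite -e fy => -[] /(congr1 val) /=; lia.
Qed.

Lemma arc_system_outside f (l : 'I_n) : x < y -> arc_system x b f ->
  f x = (y, c) -> y < l < b -> y < (f l).1 < b.
Proof.
move=> xy fA fx /andP[yl lb]; have [fI fS fN] := arc_systemP _ _ _ fA.
have fy : f y = (x, c) by have := fI x; rewrite fx.
have /andP[xfl ->] := arc_system_range fA (l := l) ltac:(lia).
rewrite andbT ltnNge; apply/negP => fly.
have /or3P[/eqP/val_inj e|/eqP/val_inj e|fin] :
  [|| (x : nat) == (f l).1, (y : nat) == (f l).1 | x < (f l).1 < y] by lia.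
- have := fI l; rewrite -e fx => -[] /(congr1 val) /=; lia.
- have := fI l; rewrite -e fy => -[] /(congr1 val) /=; lia.
(* If the partner lay inside, then so would the partner of the partner, which is [l]. *)
- have := arc_system_inside xy fA fx fin; rewrite fI /=; lia.
Qed.

Lemma glue_restrict f : x < y -> arc_system x b f -> f x = (y, c) ->
  glue_arcs (restrict_arcs x.+1 y f) (restrict_arcs y.+1 b f) = f.
Proof.
move=> xy fA fx; have [fI fS fN] := arc_systemP _ _ _ fA.
have fy : f y = (x, c) by have := fI x; rewrite fx.
apply/ffunP => l; rewrite !ffunE.
case: (eqVneq l x) => [->//|/ord_neq_lt lx].
case: (eqVneq l y) => [->//|/ord_neq_lt ly].
have out : ~~ (x <= l < b) -> f l = (l, false) by exact: arc_system_out.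
by do 2!case: ifP => //; move=> *; rewrite out //; lia.
Qed.

(** Once the arc at [x] is prescribed, cutting along it is a bijection onto pairs of independent
    systems, inside and beyond the arc. *)
Lemma card_arc_systems_fiber : x < y -> y < b -> odd x != odd y ->
  #|[set f in arc_systems x b | f x == (y, c)]| =
  #|arc_systems x.+1 y| * #|arc_systems y.+1 b|.
Proof.
move=> xy yb oxy; rewrite -cardsX.
rewrite -(@card_in_imset _ _ (fun gh => glue_arcs gh.1 gh.2)).
  apply/esym; apply: eq_card => f; rewrite !inE; apply/imsetP/andP.
    case=> -[g h]; rewrite !inE /= => /andP[gA hA] ->.
    by rewrite glue_arc_system // ffunE eqxx.
  case=> fA /eqP fx; exists (restrict_arcs x.+1 y f, restrict_arcs y.+1 b f) => /=.
    rewrite !inE /=; apply/andP; split; apply: arc_system_restrict (fA) _ => l.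
      exact: arc_system_inside.
    exact: arc_system_outside.
  by rewrite glue_restrict.
move=> [g h] [g' h']; rewrite !inE /= => /andP[gA hA] /andP[gA' hA'] e.
congr pair.
  by rewrite -(restrict_glue_l h gA) e restrict_glue_l.
by rewrite -(restrict_glue_r g xy hA) e restrict_glue_r.
Qed.

(** This includes the value [(x, true)]: an unmatched point carries only the dummy colour
    [false]. *)
Lemma arc_systems_fiber0 : (y, c) != (x, false) ->
  ~~ [&& x < y, y < b & odd x != odd y] ->
  #|[set f in arc_systems x b | f x == (y, c)]| = 0.
Proof.
move=> yc nxy; apply: eq_card0 => f; rewrite !inE.
apply/negP => /andP[fA /eqP fx]; have [fI fS _] := arc_systemP _ _ _ fA.
have fy : f y = (x, c) by have := fI x; rewrite fx.
have [e|[_ xb oxy]] := fS x; first by rewrite -e fx eqxx in yc.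
have := arc_system_range fA (l := x) ltac:(lia).
rewrite fx /= in oxy *; move=> /andP[xy yb].
by case/negP: nxy; apply/and3P; split=> //; lia.
Qed.

End Glue.

Lemma card_arc_systems_fixed b (x : 'I_n) :
  #|[set f in arc_systems x b | f x == (x, false)]| = #|arc_systems x.+1 b|.
Proof.
apply: eq_card => f; rewrite !inE; apply/andP/idP.
  case=> /arc_systemP[fI fS fN] /eqP fx; apply/arc_systemP; split=> // l.
  have [->|[xl lb ol]] := fS l; first by left.
  right; split=> //; rewrite ltn_neqAle xl andbT.
  apply: contra ol => /eqP/val_inj e.
  by rewrite -e fx.
move=> fA; rewrite (arc_system_out fA (l := x)) ?ltnn // eqxx; split=> //.
have /arc_systemP[fI fS fN] := fA; apply/arc_systemP; split=> // l.
have [->|[xl lb ol]] := fS l; [by left|right].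
by split=> //; exact: ltnW.
Qed.

(** Systems are sorted by their value at the first point [x]: unmatched, or joined to some [y]. The
    factor 2 counts the colours of the arc. *)
Lemma card_arc_systems_sum b (x : 'I_n) : x < b ->
  #|arc_systems x b| = #|arc_systems x.+1 b| +
    2 * \sum_(y < n | [&& x < y, y < b & odd x != odd y])
          #|arc_systems x.+1 y| * #|arc_systems y.+1 b|.
Proof.
move=> xb; rewrite -sum1_card.
rewrite (partition_big (fun f : {ffun 'I_n -> 'I_n * bool} => f x) predT) //=.
rewrite (eq_bigr (fun v => #|[set f in arc_systems x b | f x == v]|)); last first.
  by move=> v _; rewrite -sum1_card; apply: eq_bigl => f; rewrite !inE.
rewrite (bigD1 (x, false)) //= card_arc_systems_fixed; congr (_ + _).
rewrite big_distrr /= big_mkcond /=.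
rewrite -(pair_bigA _ (fun y c => if (y, c) != (x, false) then
   #|[set f in arc_systems x b | f x == (y, c)]| else 0)) /=.
rewrite [RHS]big_mkcond /=; apply: eq_bigr => y _.
rewrite big_bool /=; case: (boolP [&& x < y, y < b & odd x != odd y]) => [/and3P[xy yb oxy]|nxy].
  have yx : y != x by rewrite -val_eqE /=; lia.
  rewrite !xpair_eqE (negbTE yx) /=.
  by rewrite !card_arc_systems_fiber // mul2n addnn.
have fib0 c : (if (y, c) != (x, false) then
    #|[set f in arc_systems x b | f x == (y, c)]| else 0) = 0.
  by case: ifP => // yc; rewrite arc_systems_fiber0.
by rewrite !fib0.
Qed.

Lemma card_arc_systems_rec a m : a + m.+1 <= n ->
  #|arc_systems a (a + m.+1)| = #|arc_systems a.+1 (a + m.+1)| +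
    2 * \sum_(k < m.+1./2) #|arc_systems a.+1 (a.+1 + k.*2)| *
                           #|arc_systems (a + k.*2.+2) (a + m.+1)|.
Proof.
move=> amn; have an : a < n by lia.
have := @card_arc_systems_sum (a + m.+1) (Ordinal an); rewrite /= => ->; last lia.
congr (_ + 2 * _).
pose F y := #|arc_systems a.+1 y| * #|arc_systems y.+1 (a + m.+1)|.
rewrite -(big_mkord (fun y => [&& a < y, y < a + m.+1 & odd a != odd y]) F).
rewrite -(big_mkord predT (fun k => #|arc_systems a.+1 (a.+1 + k.*2)| *
                           #|arc_systems (a + k.*2.+2) (a + m.+1)|)).
(* Opposite parity leaves exactly the partners at odd distance from [a]. *)
rewrite [RHS](eq_bigr (fun k => F (a.+1 + k.*2))); last first.
  by move=> k _; rewrite /F addnS addSn addnS.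
transitivity (\sum_(a.+1 <= y < a.+1 + m | odd a != odd y) F y).
  rewrite (@big_cat_nat _ _ _ a.+1) //= [X in X + _]big_nat_cond big1 ?add0n; last by move=> i; lia.
  rewrite (@big_cat_nat _ _ _ (a.+1 + m)) //=; [|lia|lia].
  rewrite [X in _ + X]big_nat_cond [X in _ + X]big1 ?addn0; last by move=> i; lia.
  by rewrite big_nat_cond [RHS]big_nat_cond; apply: eq_bigl => i; lia.
(* [F] contains [m] in its right end; making it opaque lets the induction vary the range of
   summation alone. The new candidate [(a + m).+1] is admissible iff [m] is even. *)
clearbody F; elim: m {amn} => [|m IH]; first by rewrite addn0 !big_geq.
rewrite addnS big_mkcond big_nat_recr ?leq_addr //= -big_mkcond /= IH.
have -> : (odd a != odd (a + m).+1) = ~~ odd m by lia.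
case: (boolP (odd m)) => om /=.
  by rewrite addn0; congr (\sum_(0 <= k < _) _); lia.
have -> : uphalf m = m./2 by lia.
rewrite big_nat_recr //=; congr (_ + F _); lia.
Qed.

End ArcSystems.

(** * Counting by length: recurrences and supermultiplicativity *)

Lemma card_arc_systems_shift n n' a a' m : a + m <= n -> a' + m <= n' ->
  #|arc_systems n a (a + m)| = #|arc_systems n' a' (a' + m)|.
Proof.
(* Every interval in the recurrence is shorter than [m], with a length that depends neither on its
   position nor on the ambient line. *)
elim/ltn_ind: m n a n' a' => -[|m] IH n a n' a' am am'.
  by rewrite !arc_systems_nil // addn0.
rewrite (@card_arc_systems_rec n a m am) (@card_arc_systems_rec n' a' m am'); congr (_ + 2 * _).
  by rewrite !addnS -!addSn; apply: IH; lia.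
apply: eq_bigr => k _; have km : k.*2.+1 < m.+1 by have := ltn_ord k; lia.
congr (_ * _); first by apply: IH; lia.
have -> : a + m.+1 = a + k.*2.+2 + (m.-1 - k.*2) by lia.
have -> : a' + m.+1 = a' + k.*2.+2 + (m.-1 - k.*2) by lia.
by apply: IH; lia.
Qed.

Definition num_arc_systems m : nat := #|arc_systems m 0 m|.

Lemma card_arc_systems n a b : a <= b <= n ->
  #|arc_systems n a b| = num_arc_systems (b - a).
Proof.
case/andP=> ab bn; rewrite -[in LHS](subnKC ab).
by apply: card_arc_systems_shift; rewrite ?subnKC.
Qed.

Lemma num_arc_systems0 : num_arc_systems 0 = 1.
Proof. exact: arc_systems_nil. Qed.

Lemma num_arc_systemsS m : num_arc_systems m.+1 = num_arc_systems m +
  2 * \sum_(k < m.+1./2) num_arc_systems k.*2 * num_arc_systems (m.-1 - k.*2).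
Proof.
rewrite {1}/num_arc_systems (@card_arc_systems_rec m.+1 0) // !add0n.
rewrite card_arc_systems ?subn1 //=; congr (_ + 2 * _).
apply: eq_bigr => k _; have km : k.*2.+1 < m.+1 by have := ltn_ord k; lia.
rewrite !card_arc_systems ?add1n ?subn1 /=; try lia.
by congr (_ * num_arc_systems _); lia.
Qed.

(** [even_num] and [odd_num] are the coefficients of the generating functions E and O. *)
Definition even_num m := num_arc_systems m.*2.
Definition odd_num m := num_arc_systems m.*2.+1.

(** The coefficient form of [E = 1 + x O + 2 x E^2]: an arc at the first point encloses an even
    number of points and leaves an even number beyond. *)
Lemma even_numS m : even_num m.+1 =
  odd_num m + 2 * \sum_(k < m.+1) even_num k * even_num (m - k).
Proof.
rewrite /even_num doubleS num_arc_systemsS; congr (_ + 2 * _).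
rewrite -(big_mkord predT (fun k => num_arc_systems k.*2 * num_arc_systems (m.*2.+1.-1 - k.*2))).
rewrite big_mkord; have -> : m.*2.+2./2 = m.+1 by lia.
by apply: eq_bigr => k _; rewrite doubleB.
Qed.

(** The coefficient form of [O = E + 2 x E O]: here an odd number of points remains beyond the first
    arc. *)
Lemma odd_numE m : odd_num m =
  even_num m + 2 * \sum_(k < m) even_num k * odd_num (m.-1 - k).
Proof.
rewrite /odd_num num_arc_systemsS; congr (_ + 2 * _).
have -> : m.*2.+1./2 = m by lia.
apply: eq_bigr => k _; congr (_ * num_arc_systems _).
by have := ltn_ord k; lia.
Qed.

(** Juxtaposition of two systems gives a system; the inequality is read off the recurrence by
    induction on [a]. *)
Lemma num_arc_systems_supermul a b :
  num_arc_systems a * even_num b <= num_arc_systems (a + b.*2).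
Proof.
elim/ltn_ind: a => -[|a] IH; first by rewrite num_arc_systems0 mul1n.
rewrite addSn !num_arc_systemsS mulnDl leq_add ?IH //.
rewrite -mulnA leq_mul2l big_distrl; apply/orP; right.
rewrite -(big_mkord predT (fun k => num_arc_systems k.*2 * num_arc_systems ((a + b.*2).-1 - k.*2))).
have -> : (a + b.*2).+1./2 = a.+1./2 + b by lia.
(* Only the arcs from the first point that end within the first block are kept. *)
rewrite (@big_cat_nat _ _ _ a.+1./2) //= ?leq_addr // big_mkord.
apply: leq_trans (leq_addr _ _); apply: leq_sum => k _.
rewrite -mulnA leq_mul2l; apply/orP; right.
have := ltn_ord k; case: a IH k => [|a] IH k ka; first by move: ka; lia.
have -> : (a.+1 + b.*2).-1 - k.*2 = (a.+1.-1 - k.*2) + b.*2 by lia.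
by apply: IH; lia.
Qed.

Lemma even_num_supermul a b : even_num a * even_num b <= even_num (a + b).
Proof. by rewrite /even_num doubleD num_arc_systems_supermul. Qed.

(** * Combinatorial data sets as arc systems *)

Definition arcs_of_data d (D : comb_data d) :
    {ffun 'I_(2 * d - 2) -> 'I_(2 * d - 2) * bool} :=
  [ffun l => (D.1.1 l, l \in D.1.2)].

(** Colour [true] stands for [H]; the matched points of colour [false] form [T]. *)
Definition data_of_arcs d (f : {ffun 'I_(2 * d - 2) -> 'I_(2 * d - 2) * bool}) :
    comb_data d :=
  ([ffun l => (f l).1], finset (fun l => (f l).2),
   finset (fun l => ((f l).1 != l) && ~~ (f l).2)).

(** [T] is eliminated as the complement of [H] among the moved points, so that condition (iii)
    becomes invariance of [H] under [iota]. *)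
Lemma is_comb_dataP d (D : comb_data d) : let: (iota, H, T) := D in
  reflect [/\ involutive iota,
              forall l, (l \in T) = (iota l != l) && (l \notin H),
              forall l, iota l != l -> odd l != odd (iota l),
              forall l m : 'I_(2 * d - 2), l < m -> m < iota l -> iota l < iota m -> False &
              (forall l, l \in H -> iota l != l) /\ forall l, (iota l \in H) = (l \in H)]
          (is_comb_data D).
Proof.
case: D => [[iota H] T] /=; apply: (iffP and5P).
  move=> [/forallP iI /pred0P HT /eqP/setP HuT /forallP odI /andP[/forallP nc /forallP cl]].
  have iK : involutive iota by move=> l; exact/eqP.
  have moved l : (iota l != l) = (l \in H) || (l \in T).
    by have := HuT l; rewrite !inE.
  have HTl l : l \in H -> l \in T -> False.
    by move=> lH lT; have := HT l; rewrite /= lH lT.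
  split=> //.
  - move=> l; rewrite moved; case: (boolP (l \in H)) => //= lH.
      by apply/negP; exact: HTl.
    by rewrite andbT.
  - by move=> l; exact/implyP.
  - by move=> l m lm ml; have /forallP/(_ m) := nc l; rewrite lm ml /= => /negP.
  - have HI l : l \in H -> iota l \in H.
      move=> lH; have := cl l; rewrite moved lH /= => /orP[//|/andP[lT]].
      by case: (HTl l).
    split=> l; first by rewrite moved => ->.
    by apply/idP/idP => /HI //; rewrite iK.
move=> [iK TE od nc [HM HI]]; split.
- by apply/forallP => l; rewrite iK.
- by apply/pred0P => l /=; rewrite TE; case: (l \in H); rewrite ?andbF.
- apply/eqP/setP => l; rewrite !inE TE.
  by case: (boolP (l \in H)) => [/HM ->|_]; rewrite ?andbT.
- by apply/forallP => l; apply/implyP; exact: od.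
apply/andP; split.
  by apply/forallP => l; apply/forallP => m; apply/negP => /and3P[]; exact: nc.
apply/forallP => l; apply/implyP => il; rewrite !TE HI iK.
by rewrite (eq_sym l) il; case: (l \in H).
Qed.

Lemma arcs_of_dataK d (D : comb_data d) :
  is_comb_data D -> data_of_arcs (arcs_of_data D) = D.
Proof.
case: D => [[iota H] T] /(@is_comb_dataP d (iota, H, T))[iK TE od nc [HM HI]].
rewrite /data_of_arcs; congr (_, _, _); first by apply/ffunP => l; rewrite !ffunE.
  by apply/setP => l; rewrite inE ffunE.
by apply/setP => l; rewrite TE !inE ffunE.
Qed.

Lemma data_of_arcsK d (f : {ffun 'I_(2 * d - 2) -> 'I_(2 * d - 2) * bool}) :
  arcs_of_data (data_of_arcs f) = f.
Proof. by apply/ffunP => l; rewrite !ffunE inE /=; case: (f l). Qed.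

Lemma arc_system_arcs_of_data d (D : comb_data d) :
  is_comb_data D -> arc_system 0 (2 * d - 2) (arcs_of_data D).
Proof.
case: D => [[iota H] T] /(@is_comb_dataP d (iota, H, T))[iK TE od nc [HM HI]].
apply/arc_systemP; split=> [l|l|l m]; rewrite !ffunE /=.
- by rewrite iK HI.
- case: (eqVneq (iota l) l) => [e|/od ol]; last by right; split.
  (* A fixed point is not in [H], which yields the dummy colour. *)
  by left; rewrite e; congr pair; apply/negP => /HM; rewrite e eqxx.
- exact: nc.
Qed.

Lemma is_comb_data_of_arcs d f :
  arc_system 0 (2 * d - 2) f -> is_comb_data (@data_of_arcs d f).
Proof.
case/arc_systemP => fI fS fN.
apply/(@is_comb_dataP d (data_of_arcs f)); split.
- by move=> l; rewrite !ffunE fI.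
- by move=> l; rewrite !inE !ffunE.
- move=> l; rewrite ffunE => fl; have [e|[]//] := fS l.
  by rewrite e eqxx in fl.
- by move=> l m; rewrite !ffunE; exact: fN.
- split=> l; rewrite !inE !ffunE ?fI //.
  have [->//|[_ _ ol] _] := fS l.
  by apply: contra ol => /eqP ->.
Qed.

Lemma num_comb_dataE d : num_comb_data d = num_arc_systems (2 * d - 2).
Proof.
rewrite /num_comb_data -(card_in_imset (f := @arcs_of_data d)); last first.
  move=> D D'; rewrite !inE => DA DA' /(congr1 (@data_of_arcs d)).
  by rewrite !arcs_of_dataK.
apply: eq_card => f; rewrite inE; apply/imsetP/idP.
  by case=> D; rewrite inE => /arc_system_arcs_of_data DA ->.
move=> fA; exists (data_of_arcs f); last by rewrite data_of_arcsK.
by rewrite inE is_comb_data_of_arcs.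
Qed.

(** Degree [d.+1] has [2 * d] directions; the convention [c_1 = 1] agrees with the empty arc
    system. *)
Lemma num_classesS d : num_classes d.+1 = even_num d.
Proof.
case: d => [|d]; first by rewrite /even_num num_arc_systems0.
rewrite -[LHS]/(num_comb_data d.+2) num_comb_dataE /even_num.
by congr num_arc_systems; lia.
Qed.

(** * From data sets to classes of vector fields *)

Local Open Scope classical_set_scope.
Local Open Scope card_scope.

Lemma has_comb_data_moved (R : realType) d (P : {poly R[i]}) (D D' : comb_data d)
    (l : 'I_(2 * d - 2)) :
  is_comb_data D -> is_comb_data D' -> has_comb_data P D -> has_comb_data P D' ->
  D.1.1 l != l -> D'.1.1 l = D.1.1 l /\ ((l \in D.1.2) = (l \in D'.1.2)).
Proof.
case: D => [[iota H] T] /(@is_comb_dataP d (iota, H, T))[iK TE od nc [HM HI]].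
case: D' => [[iota' H'] T'] /(@is_comb_dataP d (iota', H', T'))[iK' TE' od' nc' [HM' HI']].
move=> hP hP' /= il.
have odd_case (k : 'I_(2 * d - 2)) : odd k -> iota k != k -> iota' k = iota k /\ ((k \in H) = (k \in H')).
  move=> ko ik; have je : ~~ odd (iota k) by have := od k ik; rewrite ko; case: odd.
  have [h t] := hP k _ ko je; have [h' t'] := hP' k _ ko je.
  case: (boolP (k \in H)) => [kH|kH].
    by have /h/h'[-> ->] : k \in H /\ iota k = iota k by [].
  have /t/t'[] : k \in T /\ iota k = iota k by rewrite TE ik kH.
  by rewrite TE' => /andP[_ /negbTE ->] ->.
(* [has_comb_data] constrains pairs through their odd member only, so an even [l] is treated through
   its partner. *)
case: (boolP (odd l)) => lo; first exact: odd_case.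
have ko : odd (iota l) by have := od l il; rewrite (negbTE lo); case: odd.
have [|e hk] := odd_case (iota l) ko; first by rewrite iK eq_sym.
rewrite iK in e; split; first by rewrite -{1}e iK'.
by rewrite -HI hk -HI' e.
Qed.

(** A field determines its data set: points moved by either involution agree by the previous lemma,
    and points fixed by both lie in neither [H]. *)
Lemma has_comb_data_inj (R : realType) d (P : {poly R[i]}) (D D' : comb_data d) :
  is_comb_data D -> is_comb_data D' -> has_comb_data P D -> has_comb_data P D' ->
  D = D'.
Proof.
move=> DA DA' hD hD'.
rewrite -(arcs_of_dataK DA) -(arcs_of_dataK DA'); congr data_of_arcs.
apply/ffunP => l; rewrite !ffunE.
have [e|/(has_comb_data_moved DA DA' hD hD')[-> ->]//] := eqVneq (D.1.1 l) l.
have [e'|/(has_comb_data_moved DA' DA hD' hD)[-> ->]//] := eqVneq (D'.1.1 l) l.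
rewrite e e'.
case: D DA e {hD} => [[iota H] T] /(@is_comb_dataP d (iota, H, T))[_ _ _ _ [HM _]] /= e.
case: D' DA' e' {hD'} => [[iota' H'] T'] /(@is_comb_dataP d (iota', H', T'))[_ _ _ _ [HM' _]] /= e'.
congr pair; apply/idP/idP => [/HM|/HM']; first by rewrite e eqxx.
by rewrite e' eqxx.
Qed.

Lemma comb_classes_card (R : realType) d : (2 <= d)%N -> all_data_realized R d ->
  @comb_classes R d #= `I_(num_classes d).
Proof.
case: d => [|[|d]] // _ real.
rewrite -[num_classes _]/(num_comb_data d.+2) /num_comb_data.
set A := finset _.
have -> : @comb_classes R d.+2 = @comb_class R d.+2 @` [set` A].
  apply/seteqP; split=> C /=.
    by case=> D [DA -> _]; exists D => //=; rewrite inE.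
  case=> D; rewrite inE => DA <-; exists D; split=> //; exact: real.
(* Equal classes share a field, as realized classes are nonempty, and that field has only one data
   set. *)
have Ainj : {in [set` A] &, injective (@comb_class R d.+2)}.
  move=> D D'; rewrite !inE => /= DA DA' e; rewrite inE in DA; rewrite inE in DA'.
  have [P PD] := real D DA; have PD' : comb_class D' P by rewrite -e.
  by case: PD PD' => _ hD [_ hD']; exact: has_comb_data_inj hD hD'.
rewrite (card_eql (inj_card_eq Ainj)) card_eq_sym.
have Iinj : {in [set` A] &, injective (index^~ (enum A))}.
  move=> D D'; rewrite !inE /= => DA DA' e.
  by rewrite -[LHS](nth_index D (s := enum A)) ?mem_enum // e nth_index ?mem_enum.
rewrite -(card_eqr (inj_card_eq Iinj)).
rewrite (_ : _ @` _ = `I_#|A|) //; apply/seteqP; split=> i /=.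
  by case=> D DA <-; rewrite cardE index_mem mem_enum.
rewrite cardE => iA; have [D0 _] : exists D0, D0 \in A.
  by apply/card_gt0P; rewrite cardE; case: (size _) iA.
exists (nth D0 (enum A) i); last by rewrite index_uniq ?enum_uniq.
by rewrite -mem_enum mem_nth.
Qed.

Local Open Scope ring_scope.

(** * Partial sums of Cauchy products *)

Section Convolution.
Variables (R : realDomainType) (a b : nat -> R).
Implicit Types m n : nat.

Lemma sum_convE n :
  \sum_(m < n) \sum_(k < m.+1) a k * b (m - k)%N =
  \sum_(k < n) a k * \sum_(i < n - k) b i.
Proof.
elim: n => [|n IH]; first by rewrite !big_ord0.
rewrite [RHS](eq_bigr (fun k : 'I_n.+1 =>
  a k * \sum_(i < n - k) b i + a k * b (n - k)%N)); last first.
  by move=> k _; rewrite subSn -1?ltnS // big_ord_recr /= mulrDr.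
rewrite big_split /= [X in X + _]big_ord_recr /= subnn big_ord0 mulr0 addr0.
by rewrite big_ord_recr /= IH.
Qed.

Hypotheses (a_ge0 : forall k, 0 <= a k) (b_ge0 : forall k, 0 <= b k).

Lemma ler_sum_ord m n (f : nat -> R) : (forall k, 0 <= f k) -> (m <= n)%N ->
  \sum_(k < m) f k <= \sum_(k < n) f k.
Proof.
move=> f0 /subnKC <-; rewrite big_split_ord /= lerDl.
by apply: sumr_ge0 => i _; exact: f0.
Qed.

(** The triangle [k + i < n] is contained in the square [k, i < n]. *)
Lemma sum_conv_le n :
  \sum_(m < n) \sum_(k < m.+1) a k * b (m - k)%N <=
  (\sum_(k < n) a k) * \sum_(k < n) b k.
Proof.
rewrite sum_convE big_distrl /=; apply: ler_sum => k _.
by rewrite ler_wpM2l // ler_sum_ord // leq_subr.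
Qed.

(** The square [k, i < n] is contained in the triangle [k + i < n + n]. *)
Lemma sum_conv_ge n :
  (\sum_(k < n) a k) * (\sum_(k < n) b k) <=
  \sum_(m < n + n) \sum_(k < m.+1) a k * b (m - k)%N.
Proof.
rewrite sum_convE [leRHS]big_split_ord /= big_distrl /= -[leLHS]addr0.
apply: lerD; last first.
  by apply: sumr_ge0 => k _; rewrite mulr_ge0 // sumr_ge0.
apply: ler_sum => k _; rewrite ler_wpM2l // ler_sum_ord //.
by have := ltn_ord k; lia.
Qed.

End Convolution.

Lemma even_num_gt0 m : (0 < even_num m)%N.
Proof.
elim: m => [|m IH]; first by rewrite /even_num num_arc_systems0.
by rewrite even_numS odd_numE; lia.
Qed.

(** * The functional equations and the critical value of x *)

Section GeneratingFunctions.
Variable R : realType.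
Implicit Types (x : R) (m n : nat).

Definition even_term x k : R := (even_num k)%:R * x ^+ k.
Definition odd_term x k : R := (odd_num k)%:R * x ^+ k.
Definition even_psum x n := \sum_(k < n) even_term x k.
Definition odd_psum x n := \sum_(k < n) odd_term x k.

Lemma even_psumS x n : even_psum x n.+1 = 1 + x * odd_psum x n +
  2 * x * \sum_(m < n) \sum_(k < m.+1) even_term x k * even_term x (m - k).
Proof.
rewrite /even_psum big_ord_recl /= /even_term expr0 /even_num num_arc_systems0 mulr1.
rewrite -addrA; congr (_ + _).
rewrite /odd_psum !big_distrr /= -big_split /=; apply: eq_bigr => m _.
rewrite -/(even_num _) even_numS natrD natrM natr_sum /bump leq0n add1n exprS.
rewrite /odd_term mulrDl; congr (_ + _); first by ring.
rewrite -!mulrA; congr (_ * _).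
rewrite mulrCA; congr (_ * _); rewrite big_distrl /=; apply: eq_bigr => k _.
rewrite natrM mulrACA -exprD subnKC //; by have := ltn_ord k; lia.
Qed.

Lemma odd_psumS x n : odd_psum x n.+1 = even_psum x n.+1 +
  2 * x * \sum_(m < n) \sum_(k < m.+1) even_term x k * odd_term x (m - k).
Proof.
rewrite /odd_psum /even_psum; under eq_bigr do rewrite /odd_term odd_numE natrD mulrDl.
rewrite big_split /=; congr (_ + _).
rewrite big_ord_recl /= big_ord0 mul0r add0r big_distrr /=.
apply: eq_bigr => m _.
rewrite natrM natr_sum /bump leq0n add1n exprS /=.
rewrite -!mulrA; congr (_ * _).
rewrite mulrCA; congr (_ * _); rewrite big_distrl /=; apply: eq_bigr => k _.
rewrite natrM mulrACA -exprD subnKC //; by have := ltn_ord k; lia.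
Qed.

Lemma even_term_ge0 x k : 0 <= x -> 0 <= even_term x k.
Proof. by move=> x0; rewrite mulr_ge0 ?exprn_ge0. Qed.

Lemma odd_term_ge0 x k : 0 <= x -> 0 <= odd_term x k.
Proof. by move=> x0; rewrite mulr_ge0 ?exprn_ge0. Qed.

Lemma even_psum_ge0 x n : 0 <= x -> 0 <= even_psum x n.
Proof. by move=> x0; apply: sumr_ge0 => k _; exact: even_term_ge0. Qed.

Lemma odd_psum_ge0 x n : 0 <= x -> 0 <= odd_psum x n.
Proof. by move=> x0; apply: sumr_ge0 => k _; exact: odd_term_ge0. Qed.

(** Any nonnegative supersolution of the system for E and O bounds the partial sums, by induction on
    [n]. *)
Lemma psum_le x (E O : R) n : 0 <= x -> 0 <= E -> 0 <= O ->
  1 + x * O + 2 * x * (E * E) <= E -> E + 2 * x * (E * O) <= O ->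
  even_psum x n <= E /\ odd_psum x n <= O.
Proof.
move=> x0 E0 O0 hE hO; elim: n => [|n [IHE IHO]].
  by rewrite /even_psum /odd_psum !big_ord0.
have et k := even_term_ge0 k x0; have ot k := odd_term_ge0 k x0.
have es := even_psum_ge0 n x0; have os := odd_psum_ge0 n x0.
have hE' : even_psum x n.+1 <= E.
  apply: le_trans hE; rewrite even_psumS; apply: lerD.
    by rewrite lerD2l ler_wpM2l.
  rewrite ler_wpM2l ?mulr_ge0 //; apply: le_trans (sum_conv_le et et n) _.
  exact: ler_pM.
split=> //; apply: le_trans hO; rewrite odd_psumS; apply: lerD => //.
rewrite ler_wpM2l ?mulr_ge0 //; apply: le_trans (sum_conv_le et ot n) _.
exact: ler_pM.
Qed.

Definition radius : R := (11 - 5 * Num.sqrt 5) / (- 2).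

Lemma sqrt5_mul : Num.sqrt 5 * Num.sqrt 5 = 5 :> R.
Proof. by rewrite -expr2 sqr_sqrtr. Qed.

(** Consecutive convergents of the continued fraction, sharp enough for [radius < 1/11] and for the
    decimal value of [1/R]. *)
Lemma sqrt5_bounds : 38 / 17 < (Num.sqrt 5 : R) < 161 / 72.
Proof.
have s0 : 0 <= Num.sqrt 5 :> R by rewrite sqrtr_ge0.
have ss := sqrt5_mul; move: (Num.sqrt 5) s0 ss => s s0 ss.
by apply/andP; split; rewrite ltNge; apply/negP => h; nra.
Qed.

Lemma radiusE : radius = (5 * Num.sqrt 5 - 11) / 2.
Proof. by rewrite /radius invrN mulrN -mulNr opprB. Qed.

Lemma radius_bounds : 0 < radius < 11^-1.
Proof.
have /andP[] := sqrt5_bounds; rewrite radiusE; move: (Num.sqrt 5) => s sb1 sb2.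
by apply/andP; split; lra.
Qed.

Lemma radius_gt0 : 0 < radius.
Proof. by have /andP[] := radius_bounds. Qed.

Lemma radiusV : radius^-1 = (11 + 5 * Num.sqrt 5) / 2.
Proof.
have r0 := lt0r_neq0 radius_gt0.
apply: (mulfI r0); rewrite divff // radiusE.
by have ss := sqrt5_mul; move: (Num.sqrt 5) ss => s ss; field: ss.
Qed.

Lemma even_psum_radius n : radius * even_psum radius n <= 1.
Proof.
have r0 := ltW radius_gt0; have /andP[sb1 sb2] := sqrt5_bounds.
have ss := sqrt5_mul.
(* E and O at the radius: [y / x] and [y / (x (1 - 2 y))] at the critical point
   [y = (3 - sqrt 5) / 4]. *)
have [] := @psum_le radius (1 + Num.sqrt 5 / 2) ((7 + 3 * Num.sqrt 5) / 4) n r0.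
- by lra.
- by lra.
- rewrite le_eqVlt; apply/orP; left; apply/eqP; rewrite radiusE.
  by move: (Num.sqrt 5) ss => s ss; field: ss.
- rewrite le_eqVlt; apply/orP; left; apply/eqP; rewrite radiusE.
  by move: (Num.sqrt 5) ss => s ss; field: ss.
move=> h _; have /andP[_ rb] := radius_bounds.
apply: le_trans (ler_wpM2l r0 h) _.
have s0 : 0 <= 1 + Num.sqrt 5 / 2 :> R by lra.
by apply: le_trans (ler_wpM2r s0 (ltW rb)) _; lra.
Qed.

Lemma is_cvg_psum (f : nat -> R) (B : R) : (forall k, 0 <= f k) ->
  (forall n, \sum_(k < n) f k <= B) -> cvgn (fun n => \sum_(k < n) f k).
Proof.
move=> f0 fB; apply: nondecreasing_is_cvgn.
  by move=> m n mn; exact: ler_sum_ord.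
by exists B => _ [n _ <-].
Qed.

(** If the sums were bounded, their limits E and O would be a supersolution at [x], and [y = x E]
    would violate the maximum of [y (1 - 2 y)^2 / (1 - y)]. *)
Lemma even_psum_unbounded x (B : R) :
  radius < x -> ~ (forall n, even_psum x n <= B).
Proof.
move=> rx eB; have x0 : 0 < x := lt_trans radius_gt0 rx.
have et k := even_term_ge0 k (ltW x0); have ot k := odd_term_ge0 k (ltW x0).
(* The first equation gives [x * odd_psum x n <= even_psum x n.+1]. *)
have oB n : odd_psum x n <= x^-1 * B.
  rewrite -(ler_pM2l x0) mulVKf ?gt_eqF //.
  apply: le_trans (eB n.+1); rewrite even_psumS addrAC lerDr addr_ge0 //.
  apply: mulr_ge0; first by rewrite mulr_ge0 // ltW.
  apply: sumr_ge0 => m _; apply: sumr_ge0 => k _.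
  exact: mulr_ge0.
have cE : cvgn (even_psum x) by exact: is_cvg_psum eB.
have cO : cvgn (odd_psum x) by exact: is_cvg_psum oB.
set E := limn (even_psum x) in cE *; set O := limn (odd_psum x) in cO *.
have leE n : even_psum x n <= E.
  by apply: nondecreasing_cvgn_le => // p q pq; exact: ler_sum_ord.
have leO n : odd_psum x n <= O.
  by apply: nondecreasing_cvgn_le => // p q pq; exact: ler_sum_ord.
have hE : 1 + x * O + 2 * x * (E * E) <= E.
  have cv : (fun n => 1 + x * odd_psum x n + 2 * x * (even_psum x n * even_psum x n))
      @ \oo --> 1 + x * O + 2 * x * (E * E).
    apply: cvgD; last by apply: cvgM; [exact: cvg_cst|exact: cvgM].
    by apply: cvgD; [exact: cvg_cst|apply: cvgM => //; exact: cvg_cst].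
  apply: (cvgr_to_le cv); apply: nearW => n; apply: le_trans (leE (n + n).+1); rewrite even_psumS.
  apply: lerD; last by rewrite ler_wpM2l ?mulr_ge0 ?(ltW x0) //; exact: sum_conv_ge.
  by rewrite lerD2l ler_wpM2l ?(ltW x0) // ler_sum_ord // leq_addr.
have hO : E + 2 * x * (E * O) <= O.
  have cv : (fun n => even_psum x n + 2 * x * (even_psum x n * odd_psum x n))
      @ \oo --> E + 2 * x * (E * O).
    by apply: cvgD => //; apply: cvgM; [exact: cvg_cst|exact: cvgM].
  apply: (cvgr_to_le cv); apply: nearW => n; apply: le_trans (leO (n + n).+1); rewrite odd_psumS.
  apply: lerD; last by rewrite ler_wpM2l ?mulr_ge0 ?(ltW x0) //; exact: sum_conv_ge.
  by apply: ler_sum_ord => //; lia.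
have E1 : 1 <= E.
  by apply: le_trans (leE 1%N); rewrite /even_psum big_ord1 /even_term /even_num num_arc_systems0 expr0 mulr1.
have O0 : 0 <= O by apply: le_trans (leO 0%N); rewrite /odd_psum big_ord0.
have y0 : 0 < x * E by rewrite mulr_gt0 //; lra.
have yO : 0 < O * (1 - 2 * (x * E)) by lra.
have y1 : 0 < 1 - 2 * (x * E).
  by rewrite ltNge; apply/negP => h; have := mulr_ge0_le0 O0 h; lra.
(* O is eliminated by adding [hE] times [x (1 - 2 y)] and [hO] times [x^2]. *)
have xy : x * (1 - x * E) <= x * E * (1 - 2 * (x * E)) ^+ 2.
  have h1 : x * (1 - 2 * (x * E)) * (1 + x * O + 2 * x * (E * E)) <= x * (1 - 2 * (x * E)) * E.
    by rewrite ler_wpM2l // mulr_ge0 // ltW.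
  have h2 : x * x * (E + 2 * x * (E * O)) <= x * x * O.
    by rewrite ler_wpM2l // mulr_ge0 // ltW.
  by rewrite -subr_ge0; nra.
have /andP[sb1 sb2] := sqrt5_bounds; have ss := sqrt5_mul.
(* At the critical value the cubic in [y] has a double root at the maximum point; its third root
   [(sqrt 5 - 1) / 2] exceeds [1/2 > y]. *)
have key : radius * (1 - x * E) - x * E * (1 - 2 * (x * E)) ^+ 2 =
    4 * (x * E - (3 - Num.sqrt 5) / 4) ^+ 2 * ((Num.sqrt 5 - 1) / 2 - x * E).
  by rewrite radiusE; move: (Num.sqrt 5) ss (x * E) => s ss y; field: ss.
have : 0 <= radius * (1 - x * E) - x * E * (1 - 2 * (x * E)) ^+ 2.
  rewrite key mulr_ge0 //; first by rewrite mulr_ge0 // sqr_ge0.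
  by lra.
have : 0 < (x - radius) * (1 - x * E) by rewrite mulr_gt0 //; lra.
by lra.
Qed.

End GeneratingFunctions.

(** * Growth of the coefficients and radius of convergence *)

Section Growth.
Variable R : realType.
Implicit Types (x : R) (m n d : nat).
Local Notation radius := (radius R).
Local Notation c d := ((num_classes d)%:R : R).

(** If all terms at [x] were at most 1, a geometric series of ratio [y / x] would bound the sums at
    any [y] between [radius] and [x]. *)
Lemma even_term_gt1 x : radius < x -> exists2 m, (0 < m)%N & 1 < even_term x m.
Proof.
move=> rx; apply: contrapT => nex.
have r0 := radius_gt0 R; have x0 : 0 < x := lt_trans r0 rx.
have tx m : even_term x m <= 1.
  rewrite leNgt; apply/negP => h; apply: nex; exists m => //.
  by case: m h => // ; rewrite /even_term /even_num num_arc_systems0 expr0 mulr1 ltxx.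
pose y := (radius + x) / 2.
have ry : radius < y by rewrite /y; lra.
have yx : y < x by rewrite /y; lra.
pose q := y / x.
have q0 : 0 < q by rewrite divr_gt0 //; lra.
have q1 : q < 1 by rewrite ltr_pdivrMr // mul1r.
apply: (@even_psum_unbounded R y (1 - q)^-1 ry) => n.
apply: (@le_trans _ _ (\sum_(k < n) q ^+ k)).
  apply: ler_sum => k _; rewrite -[leRHS]mul1r.
  have -> : even_term y k = even_term x k * q ^+ k.
    by rewrite /even_term -mulrA -exprMn /q mulrCA divff ?mulr1 // gt_eqF.
  by rewrite ler_wpM2r // exprn_ge0 // ltW.
have := @geometric_le_lim R n 1 q ler01 q0; rewrite gtr0_norm // => /(_ q1).
rewrite mul1r; apply: le_trans; rewrite /series /= big_mkord.
by under [leRHS]eq_bigr do rewrite mul1r.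
Qed.

(* Supermultiplicativity propagates a single term exceeding 1 to all later terms. *)
Lemma even_term_lower x : radius < x -> x < 1 ->
  exists2 K, 0 < K & forall n, K <= even_term x n.
Proof.
move=> rx x1; have x0 : 0 < x := lt_trans (radius_gt0 R) rx.
have [m m0 tm] := even_term_gt1 rx.
(* For [n < m] the term is at least [x ^+ n], hence at least [x ^+ m]; from [m] on, splitting off
   the term [m] reduces to [n - m]. *)
exists (x ^+ m); first exact: exprn_gt0.
elim/ltn_ind => n IH; have [nm|mn] := ltnP n m.
  apply: (@le_trans _ _ (x ^+ n)); first by rewrite ler_wiXn2l ?(ltW x0) ?(ltW x1) ?(ltnW nm).
  by rewrite ler_peMl ?exprn_ge0 ?(ltW x0) // ler1n even_num_gt0.
apply: le_trans (IH (n - m)%N _) _; first by lia.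
apply: (@le_trans _ _ (even_term x m * even_term x (n - m))).
  by rewrite ler_peMl ?(ltW tm) // even_term_ge0 // ltW.
rewrite /even_term mulrACA -exprD subnKC // ler_wpM2r ?exprn_ge0 ?(ltW x0) //.
by rewrite -natrM ler_nat -[in leqRHS](subnKC mn) even_num_supermul.
Qed.

Lemma num_classes_term x d : c d.+1 * x ^+ d.+1 = x * even_term x d.
Proof. by rewrite num_classesS /even_term exprS mulrCA. Qed.

Lemma num_classes_radius_le1 d : c d * radius ^+ d <= 1.
Proof.
case: d => [|d]; first by rewrite mul0r.
rewrite num_classes_term; apply: le_trans (even_psum_radius R d.+1).
have r0 := radius_gt0 R.
rewrite ler_wpM2l ?(ltW r0) // /even_psum big_ord_recr /= lerDr.
exact/even_psum_ge0/ltW.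
Qed.

Lemma num_classes_lower x : radius < x -> x < 1 ->
  exists2 K, 0 < K & forall d, (0 < d)%N -> K <= c d * x ^+ d.
Proof.
move=> rx x1; have x0 : 0 < x := lt_trans (radius_gt0 R) rx.
have [K K0 h] := even_term_lower rx x1.
exists (x * K) => [|[//|d] _]; first exact: mulr_gt0.
by rewrite num_classes_term ler_pM2l.
Qed.

(** The upper bound is 1. Below, the lower bound at [radius / q] gives [K * q ^+ d], which exceeds
    [(q * q) ^+ d] once [q ^+ d < K]. *)
Lemma cvg_root_num_classes :
  (c d * radius ^+ d) `^ d%:R^-1 @[d --> \oo] --> (1 : R).
Proof.
have r0 := radius_gt0 R; have r1 : radius < 1.
  by have /andP[_] := radius_bounds R; lra.
apply/cvgrPdist_le => e e0.
(* The first entry ensures [q * q >= 1 - e], the second [radius / q < 1]. *)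
pose q := Num.max (1 - e / 2) ((1 + radius) / 2).
have q0 : 0 < q by rewrite lt_max; apply/orP; right; lra.
have rq : radius < q by rewrite lt_max; apply/orP; right; lra.
have q1 : q < 1 by rewrite gt_max; apply/andP; split; lra.
have qe : 1 - e / 2 <= q by rewrite le_max lexx.
have [||K K0 hK] := @num_classes_lower (radius / q).
- by rewrite ltr_pdivlMr // gtr_pMr.
- by rewrite ltr_pdivrMr // mul1r.
have qK : \forall d \near \oo, q ^+ d < K.
  have : q ^+ d @[d --> \oo] --> (0 : R) by apply: cvg_expr; rewrite gtr0_norm.
  by move=> /cvgr_lt; apply.
near=> d.
have d0 : (0 < d)%N by near: d; exists 1%N.
have dR : d%:R != 0 :> R by rewrite pnatr_eq0 -lt0n.
have u0 : 0 <= c d * radius ^+ d by rewrite mulr_ge0 // exprn_ge0 // ltW.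
have root_expr (y : R) : 0 <= y -> (y ^+ d) `^ d%:R^-1 = y.
  by move=> y0; rewrite -powR_mulrn // -powRrM divff // powRr1.
have le1 : (c d * radius ^+ d) `^ d%:R^-1 <= 1.
  rewrite -[leRHS](root_expr 1) // expr1n.
  by apply: ge0_ler_powR; rewrite ?nnegrE ?invr_ge0 //; exact: num_classes_radius_le1.
have geq : q * q <= (c d * radius ^+ d) `^ d%:R^-1.
  rewrite -[leLHS]root_expr ?mulr_ge0 ?(ltW q0) //.
  apply: ge0_ler_powR; rewrite ?nnegrE ?invr_ge0 //.
    by rewrite exprn_ge0 // mulr_ge0 // ltW.
  rewrite exprMn.
  have -> : c d * radius ^+ d = c d * (radius / q) ^+ d * q ^+ d.
    by rewrite -mulrA -exprMn divfK // gt_eqF.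
  rewrite ler_wpM2r ?exprn_ge0 ?(ltW q0) //; apply: le_trans (hK d d0).
  by apply/ltW; near: d.
rewrite ger0_norm ?subr_ge0 // lerBlDl -lerBlDr; apply: le_trans geq.
have [h|h] := lerP 0 (1 - e / 2); last first.
  by apply: (@le_trans _ _ 0); [lra|rewrite mulr_ge0 // ltW].
by apply: le_trans (ler_pM h h qe qe); nra.
Unshelve. all: end_near.
Qed.

(** Beyond [radius] the terms do not tend to 0; the series still converges at [radius] itself, so
    the supremum is attained. *)
Lemma convergence_radius_num_classes : convergence_radius (fun d => c d) = radius%:E.
Proof.
have r0 := radius_gt0 R; apply/eqP; rewrite eq_le; apply/andP; split.
  apply: ge_ereal_sup => _ [x /= cx <-]; rewrite lee_fin leNgt; apply/negP => rx.
  (* The truncation keeps [y] below 1, where the lower bound on the terms is available. *)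
  pose y := Num.min `|x| ((1 + radius) / 2).
  have r1 : radius < 1 by have /andP[_] := radius_bounds R; lra.
  have ry : radius < y by rewrite lt_min rx; lra.
  have y1 : y < 1 by rewrite gt_min; apply/orP; right; lra.
  have yx : y <= `|x| by rewrite ge_min lexx.
  have [K K0 hK] := num_classes_lower ry y1.
  have /cvgrPdist_lt/(_ K K0)[N _ hN] := cvg_series_cvg_0 cx.
  have := hN N.+1 (leqnSn N); rewrite /= sub0r normrN normrM normrX normr_nat.
  rewrite ltNge => /negP; apply; apply: le_trans (hK N.+1 _) _ => //.
  by rewrite ler_wpM2l // lerXn2r ?nnegrE // ltW // (lt_trans r0).
apply: ereal_sup_ubound; exists radius; last by rewrite gtr0_norm.
apply: nondecreasing_is_cvgn.
  by apply: nondecreasing_series => n _ _; rewrite mulr_ge0 // exprn_ge0 // ltW.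
exists 1 => _ [[|n] _ <-]; first by rewrite /pseries /series /= big_geq.
rewrite /pseries /series /= big_mkord big_ord_recl mul0r add0r.
under eq_bigr => k _ do rewrite lift0 num_classes_term.
by rewrite -big_distrr /= even_psum_radius.
Qed.

End Growth.

(** * Counting, radius and growth rate combined *)

Theorem mainTheorem4 (R : realType) :
  let rho : R := (11 - 5 * Num.sqrt 5) / (- 2) in
  let c : nat -> R := fun d => (num_classes d)%:R in
  (forall d : nat, (2 <= d)%N -> all_data_realized R d ->
     @comb_classes R d #= `I_(num_classes d)) /\
  convergence_radius c = rho%:E /\
  c d `^ d%:R^-1 @[d --> \oo] --> rho^-1 /\
  exp_equiv c (fun d => rho^-1 ^+ d) /\
  rho^-1 = - 2 / (11 - 5 * Num.sqrt 5) /\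
  `|rho^-1 - 1109%:R / 100%:R| < 1 / 200%:R.
Proof.
have r0 := radius_gt0 R.
move=> rho c.
have rhoE : rho = radius R by [].
have root := @cvg_root_num_classes R.
split; first exact: comb_classes_card.
split; first exact: convergence_radius_num_classes.
split.
  (* For [d > 0] the root of [radius ^+ d] is [radius], so this sequence is eventually the root of
     [c d]. *)
  have : (c d * radius R ^+ d) `^ d%:R^-1 * rho^-1 @[d --> \oo] --> (1 * rho^-1 : R).
    by apply: cvgM => //; exact: cvg_cst.
  rewrite mul1r; apply: cvg_trans; apply: near_eq_cvg; near=> d.
  have d0 : d%:R != 0 :> R by rewrite pnatr_eq0 -lt0n; near: d; exists 1%N.
  rewrite powRM ?exprn_ge0 ?(ltW r0) // -powR_mulrn ?(ltW r0) // -powRrM divff //.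
  by rewrite powRr1 ?(ltW r0) // rhoE mulfK // gt_eqF.
split.
  rewrite /exp_equiv; apply: cvg_trans root; apply: near_eq_cvg; apply: nearW => d.
  by rewrite rhoE exprVn invrK.
split; first by rewrite /rho invf_div.
rewrite rhoE radiusV ltr_norml; have /andP[sb1 sb2] := sqrt5_bounds R.
have -> : 1109%:R / 100%:R = 11 + 9 / 100 :> R.
  have -> : 1109%:R = 11 * 100 + 9 :> R by rewrite -natrM -natrD.
  by rewrite mulrDl mulfK ?pnatr_eq0.
by apply/andP; split; lra.
Unshelve. all: end_near.
Qed.
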